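(* Let $d \ge 2$ and $k \ge 1$ be integers. Let $f$ be chosen uniformly at random from $L_\infty(d,k)$, and let $v_0$ denote the root of $T(d,k)$. Then for every real $x > 0$, $$\Pr( f(v_0) \geq 1+x ) \leq 2^{d+2} \cdot (9/10)^{d^{\lceil x \rceil - 1}}.$$ Moreover, if $d \ge 3$, then the constant $9/10$ above may be replaced by $(3/4)^d$, that is, for every real $x>0$, $$\Pr( f(v_0) \geq 1+x ) \leq 2^{d+2} \cdot \left((3/4)^d\right)^{d^{\lceil x \rceil - 1}}.$$
   Context: $T(d,k)$ is the rooted $d$-ary tree of depth $k$: every non-leaf vertex, including the root, has exactly $d$ children, and all leaves are at distance $k$ from the root $v_0$. A real-valued function $f$ on the vertices of a graph is called Lipschitz if $|f(u)-f(v)| \le 1$ for every pair $u,v$ of adjacent vertices. $L_\infty(d,k)$ is the family of all real-valued Lipschitz functions on the vertices of $T(d,k)$ that take the value zero on all leaves. Letting $V$ be the set of internal (non-leaf) vertices of $T(d,k)$, the family $L_\infty(d,k)$ is identified (by restriction to $V$) with a compact convex polytope $P \subseteq \mathbb{R}^V$; choosing $f$ uniformly at random from $L_\infty(d,k)$ means choosing it according to the normalized $|V|$-dimensional Lebesgue measure on $P$. *)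

(* Defs.v *)
From HB Require Import structures.
From mathcomp Require Import all_boot all_order all_algebra.
From mathcomp Require Import all_classical all_reals all_analysis.
From mathcomp Require Import lra.

Set Implicit Arguments.
Unset Strict Implicit.
Unset Printing Implicit Defensive.
Import Order.TTheory GRing.Theory Num.Theory.
Import numFieldNormedType.Exports.
Local Open Scope classical_set_scope.
Local Open Scope ring_scope.

Section lebesgue_cons.
Context (R : realType) (n : nat).
Local Notation RT := (measurableTypeR R).

Definition pair_cons (p : RT * n.-tuple RT) : n.+1.-tuple RT :=
  [tuple of p.1 :: p.2].

Lemma measurable_pair_cons : measurable_fun [set: RT * n.-tuple RT] pair_cons.
Proof. exact: measurable_cons. Qed.

Variable m : {sigma_finite_measure set (n.-tuple RT) -> \bar R}.

Definition lebesgue_cons : set (n.+1.-tuple RT) -> \bar R :=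
  pushforward (lebesgue_measure \x m)%E pair_cons.

Let lebesgue_cons0 : lebesgue_cons set0 = 0%E.
Proof. by rewrite /lebesgue_cons /pushforward preimage_set0 measure0. Qed.

Let lebesgue_cons_ge0 A : (0 <= lebesgue_cons A)%E.
Proof. by rewrite /lebesgue_cons /pushforward measure_ge0. Qed.

Let lebesgue_cons_sigma_additive : semi_sigma_additive lebesgue_cons.
Proof.
have mf := measurable_pair_cons.
exact: (@measure_semi_sigma_additive _ _ _
  (measure_function_pushforward__canonical__measure_function_Measure
     (lebesgue_measure \x m)%E mf)).
Qed.

HB.instance Definition _ := isMeasure.Build _ _ _ lebesgue_cons
  lebesgue_cons0 lebesgue_cons_ge0 lebesgue_cons_sigma_additive.

Let lebesgue_cons_sigma_finite : sigma_finite setT lebesgue_cons.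
Proof.
have /sigma_finiteP[F [TF ndF Foo]] := sigma_finiteT (@lebesgue_measure R).
have /sigma_finiteP[G [TG ndG Goo]] := sigma_finiteT m.
pose g (t : n.+1.-tuple RT) : RT * n.-tuple RT :=
  (tnth t ord0, [tuple of behead t]).
have mg : measurable_fun [set: n.+1.-tuple RT] g.
  by apply/measurable_fun_pairP; split;
    [exact: measurable_tnth|exact: measurable_behead].
have gK p : g (pair_cons p) = p.
  by case: p => x t; congr pair; apply/val_inj.
exists (fun i => g @^-1` (F i `*` G i)).
  rewrite -preimage_bigcup; apply/esym; rewrite -subTset => t _ /=.
  have [i _ Fi] : (\bigcup_i F i) (g t).1 by rewrite -TF.
  have [j _ Gj] : (\bigcup_i G i) (g t).2 by rewrite -TG.
  exists (maxn i j) => //; split.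
    by move: Fi; exact/subsetPset/ndF/leq_maxl.
  by move: Gj; exact/subsetPset/ndG/leq_maxr.
move=> i; have [mFi Fioo] := Foo i; have [mGi Gioo] := Goo i; split.
  by rewrite -[X in measurable X]setTI; apply: mg => //; exact: measurableX.
rewrite /lebesgue_cons /pushforward -comp_preimage.
rewrite (_ : g \o pair_cons = id); last by apply/funext => p /=; rewrite gK.
by rewrite preimage_id product_measure1E// lte_mul_pinfty// ge0_fin_numE.
Qed.

HB.instance Definition _ := Measure_isSigmaFinite.Build _ _ _ lebesgue_cons
  lebesgue_cons_sigma_finite.

End lebesgue_cons.

(* Lebesgue measure on R^n (on Borel sets), as the n-fold product of the
   one-dimensional Lebesgue measure; R^0 is a point of mass 1. *)
Fixpoint lebesgue_tuple (R : realType) (n : nat) :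
    {sigma_finite_measure set (n.-tuple (measurableTypeR R)) -> \bar R} :=
  match n with
  | 0 => dirac ([tuple] : 0.-tuple (measurableTypeR R))
  | n'.+1 => lebesgue_cons (lebesgue_tuple R n')
  end.

Lemma measurable_tuple_box (R : realType) n (A : 'I_n -> set (measurableTypeR R)) :
  (forall i, measurable (A i)) ->
  measurable [set t : n.-tuple (measurableTypeR R) | forall i, A i (tnth t i)].
Proof.
move=> mA.
rewrite (_ : mkset _ = \bigcap_(i in [set: 'I_n]) ((fun t => tnth t i) @^-1` A i)).
  apply: fin_bigcap_measurable => [|i _]; first exact: finite_finset.
  by rewrite -[X in measurable X]setTI; exact: measurable_tnth.
by apply/seteqP; split => t h i //=; exact: h.
Qed.

Lemma lebesgue_tuple_box (R : realType) n (A : 'I_n -> set (measurableTypeR R)) :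
  (forall i, measurable (A i)) ->
  lebesgue_tuple R n [set t | forall i, A i (tnth t i)] =
  (\prod_(i < n) lebesgue_measure (A i))%E.
Proof.
elim: n A => [|n IH] A mA.
  by rewrite big_ord0 /= diracE mem_set// => -[].
rewrite big_ord_recl /= /lebesgue_cons /pushforward.
rewrite -(IH (fun i => A (lift ord0 i)))// -product_measure1E//.
  congr (_ _); apply/seteqP; split => -[x t] /=.
    move=> h; split; first exact: (h ord0).
    by move=> i; have := h (lift ord0 i); rewrite tnthS.
  move=> [h0 h] i; have [j ->|->//] := unliftP ord0 i.
  by rewrite tnthS.
by apply: (@measurable_tuple_box _ _ (fun i => A (lift ord0 i))).
Qed.

(* A vertex of T(d,k) is the sequence of child labels on the path from the
   root to it, so its depth is its size, and the root is the empty sequence. *)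
Notation vertex d k := (k.-bseq 'I_d).

Section tree.
Context (d k : nat).

Definition tree_root : vertex d k := [bseq].

Definition child (u v : vertex d k) : bool :=
  [exists i : 'I_d, v == rcons u i :> seq 'I_d].

Definition adjacent : rel (vertex d k) :=
  fun u v => child u v || child v u.

Definition leaf : pred (vertex d k) := fun v => size v == k.

Definition internal : pred (vertex d k) := fun v => ~~ leaf v.

End tree.
Arguments tree_root : clear implicits.
Arguments internal : clear implicits.

Section L_infty.
Context (R : realType) (d k : nat).

Definition Lipschitz (f : vertex d k -> R) : Prop :=
  forall u v, adjacent u v -> `|f u - f v| <= 1.

Definition L_infty : set (vertex d k -> R) :=
  [set f | Lipschitz f /\ forall v, leaf v -> f v = 0].

(* R^V, with V the set of internal vertices listed by [enum_val]. *)
Local Notation RV := (#|internal d k|.-tuple (measurableTypeR R)).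

Definition restriction (f : vertex d k -> R) : RV :=
  [tuple f (enum_val i) | i < #|internal d k|].

Definition volume (E : set (vertex d k -> R)) : \bar R :=
  lebesgue_tuple R #|internal d k| (restriction @` E).

Definition Pr_L_infty (E : set (vertex d k -> R)) : \bar R :=
  (volume (L_infty `&` E) / volume L_infty)%E.

Definition extension (t : RV) (v : vertex d k) : R :=
  nth 0 t (index v (enum (internal d k))).

Lemma restriction_image E :
  E `<=` L_infty ->
  restriction @` E = extension @^-1` E.
Proof.
move=> EL; apply/seteqP; split => [_ [f Ef <-]|t Et] /=.
  rewrite (_ : extension _ = f)//; apply/funext => v; rewrite /extension.
  have [vi|/negPn lv] := boolP (internal d k v).
    have iv : (index v (enum (internal d k)) < #|internal d k|)%N.
      by rewrite cardE index_mem mem_enum.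
    rewrite -[X in nth _ _ X]/(nat_of_ord (Ordinal iv)) -tnth_nth tnth_mktuple.
    by congr f; rewrite (enum_val_nth v) nth_index// mem_enum.
  rewrite nth_default; first by have [_ ->] := EL _ Ef.
  rewrite size_tuple cardE leqNgt index_mem mem_enum.
  by rewrite /in_mem /= /internal negbK.
exists (extension t) => //; apply/eq_from_tnth => i.
rewrite tnth_mktuple /extension (enum_val_nth (enum_val i)) index_uniq.
- by rewrite (tnth_nth 0).
- by rewrite -cardE.
- exact: enum_uniq.
Qed.

Lemma measurable_extension v :
  measurable_fun setT (extension ^~ v).
Proof.
rewrite /extension.
have [iv|iv] := ltnP (index v (enum (internal d k))) #|internal d k|.
  rewrite (_ : (fun _ => _) = (fun t => tnth t (Ordinal iv))).
    exact: measurable_tnth.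
  by apply/funext => t; rewrite (tnth_nth 0).
rewrite (_ : (fun _ => _) = cst 0); first exact: measurable_cst.
by apply/funext => t; rewrite nth_default// size_tuple.
Qed.

Lemma measurable_restriction_L_infty : measurable (restriction @` L_infty).
Proof.
rewrite restriction_image//.
rewrite (_ : _ @^-1` _ =
    (\bigcap_(u in [set: vertex d k]) \bigcap_(v in [set v | adjacent u v])
      (fun t : RV => extension t u - extension t v) @^-1` `[-1, 1]) `&`
    \bigcap_(v in [set v : vertex d k | leaf v])
      (extension ^~ v) @^-1` [set 0]); last first.
  apply/seteqP; split => [t [tL t0]|t [tL t0]]; split.
  - by move=> u _ v /= uv; rewrite in_itv/= -ler_norml; exact: tL.
  - by move=> v /=; exact: t0.
  - by move=> u v uv; have /= := tL u I v uv; rewrite in_itv/= -ler_norml.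
  - by move=> v; exact: t0.
apply: measurableI.
  apply: fin_bigcap_measurable => [|u _]; first exact: finite_finset.
  apply: fin_bigcap_measurable => [|v _]; first exact: finite_finset.
  rewrite -[X in measurable X]setTI; apply: measurable_realfun.measurable_funB => //;
    exact: measurable_extension.
apply: fin_bigcap_measurable => [|v _]; first exact: finite_finset.
by rewrite -[X in measurable X]setTI; exact: measurable_extension.
Qed.

Lemma volume_L_infty_gt0 : (0 < volume L_infty)%E.
Proof.
pose B := [set t : RV | forall i, `[0, 1]%classic (tnth t i)].
have mB : measurable B.
  by apply: (@measurable_tuple_box _ _ (fun=> `[0, 1]%classic)).
apply: (@lt_le_trans _ _ (lebesgue_tuple R #|internal d k| B)).
  rewrite (@lebesgue_tuple_box R _ (fun=> `[0, 1]%classic))//.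
  rewrite big1// => i _; rewrite lebesgue_measure_itv/= lte_fin ltr01.
  by rewrite oppr0 adde0.
apply: le_measure; rewrite ?inE//; first exact: measurable_restriction_L_infty.
rewrite restriction_image// => t Bt.
have ext01 v : 0 <= extension t v <= 1.
  rewrite /extension.
  have [iv|iv] := ltnP (index v (enum (internal d k))) #|internal d k|.
    by have := Bt (Ordinal iv); rewrite (tnth_nth 0)/= in_itv.
  by rewrite nth_default ?size_tuple// lexx ler01.
split => [u v _|v lv].
  have /andP[u0 u1] := ext01 u; have /andP[v0 v1] := ext01 v.
  by rewrite ler_norml; apply/andP; split; lra.
rewrite /extension nth_default// size_tuple cardE leqNgt index_mem mem_enum.
by rewrite /in_mem /= /internal lv.
Qed.

Lemma L_infty_bound f v : (0 < d)%N -> L_infty f ->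
  `|f v| <= (k - size v)%:R.
Proof.
move=> d0 [fL f0].
have [m] := ubnP (k - size v); elim: m v => // m IH v.
rewrite ltnS => km.
have [lv|nlv] := boolP (leaf v); first by rewrite f0// normr0.
have sv : (size v < k)%N by rewrite ltn_neqAle nlv size_bseq.
have svP : (size (rcons v (Ordinal d0)) <= k)%N by rewrite size_rcons.
pose w : vertex d k := Bseq svP.
have vw : adjacent v w.
  by apply/orP; left; apply/existsP; exists (Ordinal d0).
have sw : (k - size w < k - size v)%N.
  by rewrite size_rcons subnS prednK ?subn_gt0.
have ks : (k - size v = (k - size w).+1)%N.
  by rewrite size_rcons subnS prednK ?subn_gt0.
have -> : f v = (f v - f w) + f w by rewrite subrK.
rewrite (le_trans (ler_normD _ _))// ks -natr1 addrC lerD//; last exact: fL.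
exact/IH/(leq_trans sw).
Qed.

Lemma volume_L_infty_lty : (0 < d)%N -> (volume L_infty < +oo)%E.
Proof.
move=> d0.
pose B := [set t : RV | forall i, `[- k%:R, k%:R]%classic (tnth t i)].
have mB : measurable B.
  by apply: (@measurable_tuple_box _ _ (fun=> `[- k%:R, k%:R]%classic)).
apply: (@le_lt_trans _ _ (lebesgue_tuple R #|internal d k| B)).
  apply: le_measure; rewrite ?inE//.
    exact: measurable_restriction_L_infty.
  move=> _ [f Lf <-] i; rewrite tnth_mktuple /= in_itv/= -ler_norml.
  by rewrite (le_trans (L_infty_bound _ d0 Lf))// ler_nat leq_subr.
rewrite (@lebesgue_tuple_box R _ (fun=> `[- k%:R, k%:R]%classic))//.
rewrite -ge0_fin_numE; last exact: prode_ge0.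
by apply: prode_fin_num => i _; rewrite lebesgue_measure_itv/=; case: ifP.
Qed.

Lemma Pr_L_infty_setT : (0 < d)%N -> Pr_L_infty setT = 1%E.
Proof.
move=> d0; rewrite /Pr_L_infty setIT divee//.
  by rewrite ge0_fin_numE ?volume_L_infty_lty// ltW// volume_L_infty_gt0.
by rewrite gt_eqF// volume_L_infty_gt0.
Qed.

End L_infty.
Arguments L_infty : clear implicits.
Arguments Pr_L_infty : clear implicits.

(* Main.v *)
Require Import Defs.
From mathcomp Require Import all_boot all_order all_algebra.
From mathcomp Require Import all_classical all_reals all_analysis.
From mathcomp Require Import measurable_realfun lra ring.
Import Order.TTheory GRing.Theory Num.Theory.
Import numFieldNormedType.Exports.
Local Open Scope classical_set_scope.
Local Open Scope ring_scope.

(* The density of the root value is, up to a constant, the profile obtained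
   from the indicator of [[-1, 1]] by iterating
     f |-> (W f / W f 0) ^ d,   W f x = the integral of f over [[x - 1, x + 1]]:
   integrating out the vertices from the leaves upwards leaves at each vertex
   the product of d equal messages from its children.  Profiles stay even and
   log-concave, so f (x + y) <= f x * f y for x, y >= 0 when f 0 = 1.  Hence,
   with a and b the integrals of f over [[0, 1]] and [[1, 2]] and
   r = (a + b) / (2 a), the next profile g satisfies g (1 + x) <= (r * f x) ^ d,
   and the decay is doubly exponential as soon as r ^ d stays away from 1.
   Since b <= f 1 * a and g 1 = r ^ d, this is immediate for d >= 3, where
   b / a <= 1 / 4 is preserved.  For d = 2 the map q |-> ((1 + q) / 2) ^ 2 has 1
   as its only fixed point and log-concavity has to be used more carefully:
   if b / a is close to 1 then f is not flat on [[0, 1]], while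
   g (1 + x) <= r ^ 2 * f x ^ 2 makes the next ratio smaller. *)

(** * Integrals over intervals *)

Section interval_integral.
Context {R : realType}.
Local Notation mu := (@lebesgue_measure R).
Implicit Types (f g : R -> R) (a b c x y : R).

Definition bounded_measurable f :=
  measurable_fun [set: measurableTypeR R] f /\ exists M, forall x, `|f x| <= M.

Definition itv_int f a b : R := \int[mu]_(x in `[a, b]) f x.

Lemma bounded_measurable_integrable f (A : set (measurableTypeR R)) :
  bounded_measurable f -> measurable A -> (mu A < +oo)%E ->
  mu.-integrable A (EFin \o f).
Proof.
move=> [mf [M fM]] mA Aoo; apply: measurable_bounded_integrable => //.
  exact: measurable_funS mf.
by exists M; split; [exact: num_real|move=> y My x _ /=; exact: le_trans (fM x) (ltW My)].
Qed.

Lemma bounded_measurable_itv_integrable f (b0 b1 : bool) a b : bounded_measurable f ->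
  mu.-integrable [set` Interval (BSide b0 a) (BSide b1 b)] (EFin \o f).
Proof.
move=> bf; apply: bounded_measurable_integrable => //=.
by rewrite lebesgue_measure_itv/=; case: ifP => // _; rewrite -EFinD ltry.
Qed.

Lemma bounded_measurable_cst c : bounded_measurable (cst c).
Proof. by split; [exact: measurable_cst|exists `|c|]. Qed.

Lemma bounded_measurableD f g : bounded_measurable f -> bounded_measurable g ->
  bounded_measurable (fun x => f x + g x).
Proof.
move=> [mf [M fM]] [mg [N gN]]; split; first exact: measurable_funD.
by exists (M + N) => x; rewrite (le_trans (ler_normD _ _))// lerD.
Qed.

Lemma bounded_measurableM f g : bounded_measurable f -> bounded_measurable g ->
  bounded_measurable (fun x => f x * g x).
Proof.
move=> [mf [M fM]] [mg [N gN]]; split; first exact: measurable_funM.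
by exists (M * N) => x; rewrite normrM ler_pM.
Qed.

Lemma bounded_measurable_shift f c : bounded_measurable f ->
  bounded_measurable (fun x => f (x + c)).
Proof.
move=> [mf [M fM]]; split; last by exists M.
apply: (measurableT_comp mf); apply: measurable_funD => //.
Qed.

Lemma bounded_measurable_opp f : bounded_measurable f ->
  bounded_measurable (fun x => f (- x)).
Proof.
move=> [mf [M fM]]; split; last by exists M.
exact: (measurableT_comp mf).
Qed.

Lemma itv_int_split f a b c : bounded_measurable f -> a <= b -> b <= c ->
  itv_int f a c = itv_int f a b + itv_int f b c.
Proof.
move=> bf ab bc; rewrite /itv_int.
have -> : \int[mu]_(x in `[b, c]) f x = \int[mu]_(x in `]b, c]) f x.
  by rewrite Rintegral_itv_obnd_cbnd//; exact: bounded_measurable_itv_integrable.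
rewrite -(@Rintegral_itvB _ f (BLeft a) (BRight c) b) ?bnd_simp//; last first.
  exact: bounded_measurable_itv_integrable.
by rewrite addrC subrK.
Qed.

Lemma itv_int_le f g a b : bounded_measurable f -> bounded_measurable g ->
  (forall x, a <= x <= b -> f x <= g x) -> itv_int f a b <= itv_int g a b.
Proof.
move=> bf bg fg; apply: le_Rintegral => //; exact: bounded_measurable_itv_integrable.
Qed.

Lemma itv_int_eq f g a b :
  (forall x, a <= x <= b -> f x = g x) -> itv_int f a b = itv_int g a b.
Proof.
by move=> fg; apply: eq_Rintegral => x; rewrite inE /= in_itv; exact: fg.
Qed.

Lemma itv_intZ k f a b : bounded_measurable f ->
  itv_int (fun x => k * f x) a b = k * itv_int f a b.
Proof.
move=> bf; apply: RintegralZl => //.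
exact: bounded_measurable_itv_integrable.
Qed.

Lemma itv_intD f g a b : bounded_measurable f -> bounded_measurable g ->
  itv_int (fun x => f x + g x) a b = itv_int f a b + itv_int g a b.
Proof.
move=> bf bg; apply: RintegralD => //;
  exact: bounded_measurable_itv_integrable.
Qed.

Lemma itv_int_cst k a b : a <= b -> itv_int (fun=> k) a b = k * (b - a).
Proof.
move=> ab; rewrite /itv_int Rintegral_cst//= lebesgue_measure_itv/= lte_fin.
case: ltP => // ba; rewrite (le_anti _ : a = b) ?ab//= subrr//.
Qed.

Lemma itv_int_ge0 f a b : (forall x, a <= x <= b -> 0 <= f x) -> 0 <= itv_int f a b.
Proof.
by move=> f0; apply: Rintegral_ge0 => x; rewrite /= in_itv; exact: f0.
Qed.

Definition translate c (x : measurableTypeR R) : measurableTypeR R := x + c.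

Lemma measurable_translate c :
  measurable_fun [set: measurableTypeR R] (translate c).
Proof. exact: measurable_funD. Qed.

Lemma lebesgue_measure_translate c (A : set (measurableTypeR R)) : measurable A ->
  mu A = pushforward mu (translate c) A.
Proof.
move=> mA; have mf := measurable_translate c.
apply: (@lebesgue_measure_unique _
  (measure_function_pushforward__canonical__measure_function_Measure mu mf)) => //.
move=> _ [[x y] /= _ <-]; rewrite /pushforward.
rewrite (_ : _ @^-1` _ = `]x - c, y - c]%classic); last first.
  by apply/seteqP; split => z /=; rewrite !in_itv/= ltrBlDr lerBrDr.
rewrite lebesgue_measure_itv lebesgue_measure_itv/= !lte_fin ltrD2r.
by rewrite -!EFinD opprB addrA subrK.
Qed.

Lemma ge0_integral_shift f c : bounded_measurable f -> (forall x, 0 <= f x) ->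
  (\int[mu]_x (f (x + c)%R)%:E = \int[mu]_x (f x)%:E)%E.
Proof.
move=> [mf _] f0; have ms := measurable_translate c.
have -> : (\int[mu]_x (f x)%:E = \int[pushforward mu (translate c)]_x (f x)%:E)%E.
  apply: (eq_measure_integral
    (measure_function_pushforward__canonical__measure_function_Measure mu ms)) => A mA _.
  exact: lebesgue_measure_translate.
rewrite (ge0_integral_pushforward ms) ?preimage_setT//.
  exact/measurable_EFinP.
by move=> x _; rewrite lee_fin.
Qed.

Lemma itv_int_shift f a b c : bounded_measurable f ->
  itv_int f (a + c) (b + c) = itv_int (fun x => f (x + c)) a b.
Proof.
move=> bf; have ms := measurable_translate c; congr fine.
have preE : (translate c) @^-1`
    `[a + c, b + c]%classic = `[a, b]%classic.
  by apply/seteqP; split => z /=; rewrite !in_itv/= !lerD2r.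
have -> : (\int[mu]_(x in `[(a + c)%R, (b + c)%R]) (f x)%:E =
    \int[pushforward mu (translate c)]_(x in `[(a + c)%R, (b + c)%R])
      (f x)%:E)%E.
  apply: (eq_measure_integral
    (measure_function_pushforward__canonical__measure_function_Measure mu ms)) => A mA _.
  exact: lebesgue_measure_translate.
rewrite (integral_pushforward ms)//.
- by rewrite preE.
- by apply/measurable_EFinP; case: bf.
- rewrite preE; apply: (bounded_measurable_itv_integrable (fun x => f (x + c))).
  exact: bounded_measurable_shift.
Qed.

Lemma itv_int_opp f a b : bounded_measurable f ->
  itv_int f (- b) (- a) = itv_int (fun x => f (- x)) a b.
Proof.
move=> bf; congr fine.
have ms : measurable_fun [set: measurableTypeR R] (-%R : _ -> measurableTypeR R) by [].
have preE : (-%R : _ -> measurableTypeR R) @^-1` `[- b, - a]%classic = `[a, b]%classic.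
  by rewrite opp_preimage_itvbndbnd !opprK.
have -> : (\int[mu]_(x in `[(- b)%R, (- a)%R]) (f x)%:E =
    \int[pushforward mu (-%R : _ -> measurableTypeR R)]_(x in `[(- b)%R, (- a)%R])
      (f x)%:E)%E.
  apply: (eq_measure_integral
    (measure_function_pushforward__canonical__measure_function_Measure mu ms)) => A mA _.
  exact/esym/lebesgue_measureN.
rewrite (integral_pushforward ms)//.
- by rewrite preE.
- by apply/measurable_EFinP; case: bf.
- rewrite preE; apply: (bounded_measurable_itv_integrable (fun x => f (- x))).
  exact: bounded_measurable_opp.
Qed.

End interval_integral.

(** * Even log-concave profiles *)

Section profile.
Context {R : realType}.
Implicit Types (f g : R -> R) (a b c x y : R).

(** The hypothesis is integrated first in [u], then in [v], one factor being constant each time. *)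
Lemma itv_int_mul_le (f1 f2 g1 g2 : R -> R) a b c d :
  bounded_measurable f1 -> bounded_measurable f2 ->
  bounded_measurable g1 -> bounded_measurable g2 ->
  (forall u v, a <= u <= b -> c <= v <= d -> f1 u * f2 v <= g1 u * g2 v) ->
  itv_int f1 a b * itv_int f2 c d <= itv_int g1 a b * itv_int g2 c d.
Proof.
move=> bf1 bf2 bg1 bg2 fg; have bc := @bounded_measurable_cst R.
have fgI v : c <= v <= d -> itv_int f1 a b * f2 v <= itv_int g1 a b * g2 v.
  move=> cvd; rewrite mulrC [leRHS]mulrC -!itv_intZ//.
  apply: itv_int_le; [exact: (bounded_measurableM (cst _))..|] => u aub.
  by rewrite mulrC [leRHS]mulrC; exact: fg.
rewrite -!itv_intZ//; apply: itv_int_le => //; exact: (bounded_measurableM (cst _)).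
Qed.

(* Log-concavity is stated multiplicatively, so that zeros of [f] need no
   special treatment. *)
Record profile f : Prop := Profile {
  profile_ge0 : forall x, 0 <= f x ;
  profile0 : f 0 = 1 ;
  profileN : forall x, f (- x) = f x ;
  profile_lc : forall x y t, y <= x -> 0 <= t ->
    f (x + t) * f y <= f x * f (y + t) ;
  profile_half : 0 < f (1 / 2) }.

(** Log-concavity at [x] and [- y] with shift [y - x] reads [f y ^+ 2 <= f x ^+ 2] by evenness. *)
Lemma profile_noninc f x y : profile f -> 0 <= x -> x <= y -> f y <= f x.
Proof.
move=> pf x0 xy; have f0 := profile_ge0 _ pf.
rewrite -(@ler_pXn2r _ 2)// ?nnegrE//.
have := @profile_lc _ pf x (- y) (y - x) _ _.
rewrite (_ : x + (y - x) = y); last by ring.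
rewrite (_ : - y + (y - x) = - x); last by ring.
by rewrite !(profileN _ pf) -!expr2; apply; lra.
Qed.

Lemma profile_le1 f x : profile f -> f x <= 1.
Proof.
move=> pf; rewrite -(profile0 _ pf); have [x0|x0] := leP 0 x.
  exact: profile_noninc.
by rewrite -(profileN _ pf); apply: profile_noninc => //; lra.
Qed.

Lemma profile_sub f x y : profile f -> 0 <= x -> 0 <= y -> f (x + y) <= f x * f y.
Proof.
move=> pf x0 y0; have := @profile_lc _ pf x 0 y x0 y0.
by rewrite add0r profile0// mulr1.
Qed.

(** Superlevel sets are intervals, and closed rays generate the Borel sets. *)
Lemma unimodal_measurable f :
  (forall x y z, x <= y -> y <= z -> f x <= f y \/ f z <= f y) ->
  measurable_fun [set: measurableTypeR R] f.
Proof.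
move=> uf; apply: (measurability _ (RGenCInfty.measurableE R)).
move=> /= _ [_ [c ->] <-]; rewrite setTI; apply: is_interval_measurable.
move=> x z /=; rewrite !in_itv/= !andbT => cx cz y /andP[xy yz].
by rewrite in_itv/= andbT; case: (uf x y z xy yz) => ?; lra.
Qed.

Lemma profile_bounded_measurable f : profile f -> bounded_measurable f.
Proof.
move=> pf; split; last first.
  by exists 1 => x; rewrite ger0_norm ?profile_le1//; exact: profile_ge0.
apply: unimodal_measurable => x y z xy yz; have [y0|y0] := leP 0 y.
  by right; exact: profile_noninc.
left; rewrite -[f x](profileN _ pf) -[f y](profileN _ pf).
by apply: profile_noninc => //; lra.
Qed.

Definition window f x : R := itv_int f (x - 1) (x + 1).

Lemma windowE f x : bounded_measurable f ->
  window f x = itv_int (fun u => f (u + x)) (- 1) 1.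
Proof.
by move=> bf; rewrite -(itv_int_shift f (- 1) 1 x bf) ![_ + x]addrC.
Qed.

Lemma window_shiftE f x t : bounded_measurable f ->
  window f (x + t) = itv_int (fun u => f (u + x)) (t - 1) (t + 1).
Proof.
move=> bf; rewrite -(itv_int_shift f _ _ x bf) /window.
by rewrite -![x + t + _]addrA ![_ + x]addrC.
Qed.

(* For [t <= 2] the windows at [x] and [x + t] overlap; after cutting them at the
   common endpoints the overlap cancels and every remaining pair of pieces is
   ordered, so that log-concavity applies pointwise under the integrals. *)
Lemma window_lc f x y t : profile f -> y <= x -> 0 <= t ->
  window f (x + t) * window f y <= window f x * window f (y + t).
Proof.
move=> pf yx t0; have bf := profile_bounded_measurable _ pf.
have bs c := bounded_measurable_shift f c bf.
have [t2|t2] := leP t 2; last first.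
  (* For [t > 2] every shift [u + t - v] with [u], [v] in [[-1, 1]] is positive, so log-concavity
     applies pointwise. *)
  rewrite [leRHS]mulrC !windowE//.
  apply: itv_int_mul_le => // u v /andP[u1 u2] /andP[v1 v2].
  have := @profile_lc _ pf (v + x) (v + y) (u + t - v) _ _.
  rewrite [_ * f (v + _ + _)]mulrC.
  rewrite (_ : v + x + (u + t - v) = u + (x + t)); last by ring.
  rewrite (_ : v + y + (u + t - v) = u + (y + t)); last by ring.
  by apply; lra.
pose J z := itv_int (fun u => f (u + z)).
have wE z : window f z = J z (-1) (t - 1) + J z (t - 1) 1.
  rewrite -[z in LHS]addr0 window_shiftE// sub0r add0r /J -itv_int_split//; lra.
have wtE z : window f (z + t) = J z (t - 1) 1 + J z 1 (t + 1).
  rewrite window_shiftE// /J -itv_int_split//; lra.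
have le_pair a b c d : b <= c -> J x c d * J y a b <= J x a b * J y c d.
  move=> bc; rewrite mulrC /J; apply: itv_int_mul_le => // u v /andP[? ub] /andP[cv ?].
  have := @profile_lc _ pf (u + x) (u + y) (v - u) _ _.
  rewrite (_ : u + x + (v - u) = v + x); last by ring.
  rewrite (_ : u + y + (v - u) = v + y); last by ring.
  by rewrite mulrC; apply; lra.
have := le_pair (-1) (t - 1) (t - 1) 1 (lexx _).
have := le_pair (-1) (t - 1) 1 (t + 1) ltac:(lra).
have := le_pair (t - 1) 1 1 (t + 1) (lexx _).
rewrite !wtE (wE x) (wE y); nra.
Qed.

Lemma windowN f x : profile f -> window f (- x) = window f x.
Proof.
move=> pf; rewrite /window.
rewrite (_ : - x - 1 = - (x + 1)); last by ring.
rewrite (_ : - x + 1 = - (x - 1)); last by ring.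
rewrite itv_int_opp//; last exact: profile_bounded_measurable.
by apply: itv_int_eq => y _; exact: profileN.
Qed.

Lemma window_ge0 f x : profile f -> 0 <= window f x.
Proof. by move=> pf; apply: itv_int_ge0 => y _; exact: profile_ge0. Qed.

(** Such a window contains [[-1/2, 1/2]], where [f >= f (1 / 2) > 0]. At 0 and [1 / 2] this lets
    [profile_half] survive a step. *)
Lemma window_gt0 f x : profile f -> - (1 / 2) <= x <= 1 / 2 -> 0 < window f x.
Proof.
move=> pf /andP[x1 x2].
have bf := profile_bounded_measurable _ pf; have f0 := profile_ge0 _ pf.
rewrite /window (itv_int_split f (x - 1) (- (1 / 2)) (x + 1))//; [|lra..].
rewrite (itv_int_split f (- (1 / 2)) (1 / 2) (x + 1))//; [|lra..].
have : f (1 / 2) * (1 / 2 - - (1 / 2)) <= itv_int f (- (1 / 2)) (1 / 2).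
  rewrite -itv_int_cst; last lra.
  apply: itv_int_le => //; first exact: bounded_measurable_cst.
  move=> y /andP[y1 y2]; have [y0|y0] := leP 0 y; first exact: profile_noninc.
  by rewrite -[f y](profileN _ pf); apply: profile_noninc => //; lra.
have I0 a b : 0 <= itv_int f a b by exact: itv_int_ge0.
have := I0 (x - 1) (- (1 / 2)); have := I0 (1 / 2) (x + 1).
by have := profile_half _ pf; lra.
Qed.

Definition step d f x : R := (window f x / window f 0) ^+ d.

Lemma profile_step d f : profile f -> profile (step d f).
Proof.
move=> pf; have w0 : 0 < window f 0 by apply: window_gt0 => //; apply/andP; split; lra.
have wp x : 0 <= window f x by exact: window_ge0.
split.
- by move=> x; rewrite exprn_ge0// divr_ge0.
- by rewrite /step divff ?gt_eqF// expr1n.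
- by move=> x; rewrite /step windowN.
- move=> x y t yx t0; rewrite /step -!exprMn; apply: lerXn2r;
    rewrite ?nnegrE ?mulr_ge0 ?divr_ge0 ?invr_ge0 ?(ltW w0)//.
  rewrite !mulf_div ler_pM2r ?invr_gt0 ?mulr_gt0//.
  exact: window_lc.
- by rewrite exprn_gt0// divr_gt0// window_gt0//; apply/andP; split; lra.
Qed.

End profile.

(** * One step of the recursion *)

Section step_decay.
Context {R : realType}.
Implicit Types (f g : R -> R) (a b c x y : R).

Definition near_mass f : R := itv_int f 0 1.
Definition far_mass f : R := itv_int f 1 2.
(** For a profile this is [window f 1 / window f 0], the [d]-th root of the next profile at 1. *)
Definition edge_ratio f : R := (near_mass f + far_mass f) / (2 * near_mass f).

Lemma window0 f : profile f -> window f 0 = 2 * near_mass f.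
Proof.
move=> pf; have bf := profile_bounded_measurable _ pf.
rewrite /window sub0r add0r (itv_int_split f (- 1) 0 1)//; [|lra..].
have -> : itv_int f (- 1) 0 = near_mass f.
  rewrite -[X in itv_int f _ X]oppr0 itv_int_opp//.
  by apply: itv_int_eq => y _; exact: profileN.
by rewrite /near_mass mulr2n mulrDl mul1r.
Qed.

Lemma near_mass_gt0 f : profile f -> 0 < near_mass f.
Proof.
move=> pf; have := @window_gt0 _ f 0 pf _; rewrite window0// => w.
suff : 0 < 2 * near_mass f by lra.
by apply: w; apply/andP; split; lra.
Qed.

Lemma far_mass_ge0 f : profile f -> 0 <= far_mass f.
Proof. by move=> pf; apply: itv_int_ge0 => x _; exact: profile_ge0. Qed.

Lemma edge_ratio_ge0 f : profile f -> 0 <= edge_ratio f.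
Proof.
move=> pf; have := near_mass_gt0 _ pf; have := far_mass_ge0 _ pf => b0 a0.
by rewrite divr_ge0//; lra.
Qed.

Lemma window1 f : profile f -> window f 1 = near_mass f + far_mass f.
Proof.
move=> pf; rewrite /window subrr.
by rewrite (itv_int_split f 0 1 (1 + 1)) ?lerDl//; exact: profile_bounded_measurable.
Qed.

Lemma step1 d f : profile f -> step d f 1 = edge_ratio f ^+ d.
Proof. by move=> pf; rewrite /step window1// window0. Qed.

(** The window at [1 + x] is [[0, 2]] shifted by [x]; submultiplicativity takes [f x] out and leaves
    the window at 1. *)
Lemma step_succ d f x : profile f -> 0 <= x ->
  step d f (1 + x) <= (f x * edge_ratio f) ^+ d.
Proof.
move=> pf x0; have bf := profile_bounded_measurable _ pf; have a0 := near_mass_gt0 _ pf.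
rewrite /step; apply: lerXn2r; rewrite ?nnegrE.
- by apply: divr_ge0; exact: window_ge0.
- by apply: mulr_ge0; [exact: profile_ge0|exact: edge_ratio_ge0].
rewrite window0// mulrA ler_pM2r ?invr_gt0; last lra.
rewrite /window (_ : 1 + x - 1 = 0 + x); last by ring.
rewrite (_ : 1 + x + 1 = 2 + x); last by ring.
rewrite itv_int_shift// (itv_int_split _ 0 1 2) ?ler1n//; last first.
  exact: bounded_measurable_shift.
rewrite mulrDr -!itv_intZ//.
have bs := bounded_measurable_shift _ x bf.
have bm := bounded_measurableM (cst (f x)) _ (bounded_measurable_cst _) bf.
by apply: lerD; apply: itv_int_le => // y /andP[y0 _];
  rewrite addrC; apply: profile_sub => //; lra.
Qed.

Lemma far_massE f : profile f -> far_mass f = itv_int (fun x => f (x + 1)) 0 1.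
Proof.
by move=> pf; rewrite -itv_int_shift ?add0r//; exact: profile_bounded_measurable.
Qed.

Lemma far_mass_le f : profile f -> far_mass f <= f 1 * near_mass f.
Proof.
move=> pf; have bf := profile_bounded_measurable _ pf; rewrite far_massE// -itv_intZ//.
apply: itv_int_le; first exact: bounded_measurable_shift.
  exact: (bounded_measurableM (cst _) _ (bounded_measurable_cst _)).
by move=> x /andP[x0 _]; rewrite addrC; apply: profile_sub.
Qed.

Lemma itv_int_reflect f : bounded_measurable f ->
  itv_int (fun x => f (1 - x)) 0 1 = itv_int f 0 1.
Proof.
move=> bf; have bs := bounded_measurable_shift _ 1 bf.
have := itv_int_opp _ 0 1 bs; rewrite -itv_int_shift// addNr oppr0 add0r => ->.
by apply: itv_int_eq => x _; rewrite addrC.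
Qed.

(* Log-concavity gives [f (1 + x) * f (1 - x) <= f 1 ^+ 2], and [1 / p] lies
   below its chord on [[f 1, 1]]. *)
Lemma far_mass_le_chord f : profile f ->
  far_mass f <= f 1 ^+ 2 + f 1 * (1 - near_mass f).
Proof.
move=> pf; have bf := profile_bounded_measurable _ pf; rewrite far_massE//.
have bc := @bounded_measurable_cst R.
have b1 : bounded_measurable (fun x => f (1 - x)).
  have := bounded_measurable_opp _ (bounded_measurable_shift _ 1 bf).
  by under eq_fun do rewrite addrC.
have bm : bounded_measurable (fun x => - f 1 * f (1 - x)).
  exact: (bounded_measurableM (cst _)).
have -> : f 1 ^+ 2 + f 1 * (1 - near_mass f) =
    itv_int (fun x => f 1 ^+ 2 + f 1 + - f 1 * f (1 - x)) 0 1.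
  rewrite (itv_intD (cst (f 1 ^+ 2 + f 1)))// itv_intZ// itv_int_reflect// itv_int_cst//.
  by rewrite /near_mass; ring.
apply: itv_int_le; first exact: bounded_measurable_shift.
  exact: (bounded_measurableD (cst _)).
move=> x /andP[x0 x1].
have q0 := profile_ge0 _ pf 1; have p1 := profile_le1 _ (1 - x) pf.
have s0 := profile_ge0 _ pf (x + 1).
have qp : f 1 <= f (1 - x) by apply: profile_noninc => //; lra.
have sq : f (x + 1) <= f 1 by apply: profile_noninc => //; lra.
have x1' : 1 - x <= 1 by lra.
have := @profile_lc _ _ pf 1 (1 - x) x x1' x0.
rewrite subrK [1 + x]addrC => sp.
have [p0|p0] := leP (f (1 - x)) 0; first nra.
move: (f (x + 1)) (f (1 - x)) (f 1) q0 p1 s0 qp sq sp => s p q q0 p1 s0 qp sq sp.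
have [ple0|pgt0] := leP p 0.
  have q00 : q = 0 by lra.
  by move: sq; rewrite q00; lra.
(* After multiplication by [p], the claimed bound exceeds [q ^+ 2] by exactly
   [q * ((p - q) * (1 - p))]. *)
rewrite -(ler_pM2r pgt0).
have : 0 <= q * ((p - q) * (1 - p)) by rewrite !mulr_ge0// subr_ge0.
nra.
Qed.

(** Since [r <= f x <= 1] on [[0, 1]], the square lies below its chord:
    [(1 - f x) * (f x - r) >= 0]. *)
Lemma itv_int_sqr_le f r : profile f -> r <= f 1 ->
  itv_int (fun x => f x ^+ 2) 0 1 <= (1 + r) * near_mass f - r.
Proof.
move=> pf rf; have bf := profile_bounded_measurable _ pf.
have bc := @bounded_measurable_cst R.
have bm : bounded_measurable (fun x => (1 + r) * f x).
  exact: (bounded_measurableM (cst _)).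
have -> : (1 + r) * near_mass f - r =
    itv_int (fun x => (1 + r) * f x + - r) 0 1.
  by rewrite (itv_intD _ (cst (- r)))// itv_intZ// itv_int_cst// /near_mass; ring.
apply: itv_int_le; [exact: bounded_measurableM|exact: (bounded_measurableD _ (cst _))|].
move=> x /andP[x0 x1]; have := profile_le1 _ x pf.
have : f 1 <= f x by exact: profile_noninc.
nra.
Qed.

(** Keeping [f x ^+ 2] under the integral lets a drop of [f] on [[0, 1]] lower the next far mass. *)
Lemma far_mass_step2 f : profile f ->
  far_mass (step 2 f) <= edge_ratio f ^+ 2 * itv_int (fun x => f x ^+ 2) 0 1.
Proof.
move=> pf; have bf := profile_bounded_measurable _ pf; have pg := profile_step 2 _ pf.
have b2 : bounded_measurable (fun x => f x ^+ 2) by exact: bounded_measurableM.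
rewrite far_massE// -itv_intZ//; apply: itv_int_le.
- exact/bounded_measurable_shift/profile_bounded_measurable.
- exact: (bounded_measurableM (cst _) _ (bounded_measurable_cst _)).
- move=> x /andP[x0 _]; rewrite addrC mulrC -exprMn; exact: step_succ.
Qed.

(** For the next profile [g], log-concavity and [g 0 = 1] give [g x * g (1 - x) >= g 1], the square
    of the edge ratio; the arithmetic-geometric mean inequality is then averaged over [[0, 1]]. *)
Lemma near_mass_step2 f : profile f -> edge_ratio f <= near_mass (step 2 f).
Proof.
move=> pf; have pg := profile_step 2 _ pf; have bg := profile_bounded_measurable _ pg.
set g := step 2 f in pg bg *.
have b1 : bounded_measurable (fun x => g (1 - x)).
  have := bounded_measurable_opp _ (bounded_measurable_shift _ 1 bg).
  by under eq_fun do rewrite addrC.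
suff : itv_int (cst (2 * edge_ratio f)) 0 1 <= itv_int (fun x => g x + g (1 - x)) 0 1.
  by rewrite itv_intD// itv_int_reflect// itv_int_cst// /near_mass; lra.
apply: itv_int_le; [exact: bounded_measurable_cst|exact: bounded_measurableD|].
move=> x /andP[x0 x1] /=.
have x1' : 0 <= 1 - x by lra.
have := @profile_lc _ _ pg x 0 (1 - x) x0 x1'.
rewrite [x + _]addrC subrK add0r (profile0 _ pg) mulr1 {1}/g step1//.
have := edge_ratio_ge0 _ pf; have := profile_ge0 _ pg x; have := profile_ge0 _ pg (1 - x).
move: (edge_ratio f) (g x) (g (1 - x)) => r u v v0 u0 r0 ruv.
rewrite -(@ler_pXn2r _ 2) ?nnegrE//; [|lra..].
have := sqr_ge0 (u - v); nra.
Qed.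

Lemma edge_ratio_le f r : profile f -> far_mass f <= r * near_mass f ->
  edge_ratio f <= (1 + r) / 2.
Proof.
move=> pf br; have a0 := near_mass_gt0 _ pf.
rewrite ler_pdivrMr; last lra.
lra.
Qed.

(* If the far mass exceeds [22 / 25] of the near mass, the second part keeps [f 1]
   away from 1, which makes the near mass, hence the next far mass, small; if it
   does not, then [((1 + 22 / 25) / 2) ^ 2 < 89 / 100] suffices. *)
Definition binary_invariant f : Prop := far_mass f <= 89 / 100 * near_mass f /\
  (far_mass f <= 22 / 25 * near_mass f \/ f 1 <= 179 / 200).

Lemma binary_invariant_step f : profile f ->
  binary_invariant f -> binary_invariant (step 2 f).
Proof.
move=> pf [br bor]; have pg := profile_step 2 _ pf.
have c0 := edge_ratio_ge0 _ pf; have a0 := near_mass_gt0 _ pf.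
have cle := edge_ratio_le _ _ pf br.
have a'0 := near_mass_gt0 _ pg; have b'q := far_mass_le _ pg.
(* [edge_ratio f <= 189 / 200], whose square is below [179 / 200]: the second part holds after any
   step. *)
split; last by right; rewrite step1//; nra.
have [/(edge_ratio_le _ _ pf) cle'|ab] := leP (far_mass f) (22 / 25 * near_mass f).
  rewrite step1// in b'q; apply: le_trans b'q _.
  by rewrite ler_pM2r//; nra.
have q1 : f 1 <= 179 / 200 by case: bor => //; lra.
have bq := far_mass_le _ pf.
have qr : 22 / 25 <= f 1 by rewrite -(ler_pM2r a0); lra.
have chord := far_mass_le_chord _ pf.
(* With [q = f 1], the chord bound and [far_mass f > 22 / 25 * near_mass f] give [(22 / 25 + q) *
   near_mass f <= q * (1 + q)]; then [q <= 179 / 200] suffices. *)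
have a1 : near_mass f <= 24 / 25.
  have q0 : 0 < 22 / 25 + f 1 by lra.
  rewrite -(ler_pM2l q0); nra.
have sq := itv_int_sqr_le _ _ pf qr.
have := far_mass_step2 _ pf; have := near_mass_step2 _ pf.
move: sq; set I := itv_int _ 0 1 => sq ca' b'.
have I1 : I <= 37 / 40 by lra.
(* One factor [edge_ratio f] is at most the next near mass; the rest is at most
   [189 / 200 * (37 / 40) < 89 / 100]. *)
have : edge_ratio f ^+ 2 * I <= edge_ratio f ^+ 2 * (37 / 40).
  by rewrite ler_wpM2l// sqr_ge0.
have : edge_ratio f * edge_ratio f <= edge_ratio f * (189 / 200).
  by rewrite ler_wpM2l//; lra.
lra.
Qed.

End step_decay.

(** * Decay of the root profiles *)

Section root_profile.
Context {R : realType}.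
Local Notation mu := (@lebesgue_measure R).
Implicit Types (f g : R -> R) (a b c x y : R).

(** The next profile at 1 is [edge_ratio f ^+ d] with [edge_ratio f <= 5 / 8], and
    [(5 / 8) ^+ 3 < 1 / 4]. *)
Lemma far_mass_step_le_quarter d f : (3 <= d)%N -> profile f ->
  far_mass f <= 1 / 4 * near_mass f ->
  far_mass (step d f) <= 1 / 4 * near_mass (step d f).
Proof.
move=> d3 pf ba; have pg := profile_step d _ pf.
have c0 := edge_ratio_ge0 _ pf; have a'0 := near_mass_gt0 _ pg.
have cle := edge_ratio_le _ _ pf ba.
apply: le_trans (far_mass_le _ pg) _; rewrite ler_pM2r// step1//.
have c3 : edge_ratio f ^+ 3 <= (5 / 8) ^+ 3 by apply: lerXn2r; rewrite ?nnegrE; lra.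
have : edge_ratio f ^+ d <= edge_ratio f ^+ 3 by apply: ler_wiXn2l => //; lra.
lra.
Qed.

(** Both the Lipschitz constraint on an edge, as a function of the difference of labels, and the
    message of a leaf, whose value is 0. *)
Definition box x : R := (`|x| <= 1)%R%:R.

Lemma profile_box : profile box.
Proof.
split; rewrite /box.
- by move=> x; rewrite ler0n.
- by rewrite normr0 ler01.
- by move=> x; rewrite normrN.
- move=> x y t yx t0; rewrite -!natrM ler_nat !mulnb.
  have [/andP[xt y1]|//] := boolP ((`|x + t| <= 1) && (`|y| <= 1)).
  have -> : `|x| <= 1 by rewrite ler_norml; move: xt y1; rewrite !ler_norml; lra.
  by have -> : `|y + t| <= 1 by rewrite ler_norml; move: xt y1; rewrite !ler_norml; lra.
- by rewrite ler_norml (_ : _ && _)//; apply/andP; split; lra.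
Qed.

Lemma far_mass_box : far_mass box = 0.
Proof.
(* [box 1 = 1], so the endpoint 1 is removed first. *)
rewrite /far_mass /itv_int -Rintegral_itv_obnd_cbnd; last first.
  exact/bounded_measurable_itv_integrable/profile_bounded_measurable/profile_box.
rewrite (@eq_Rintegral _ _ _ _ _ (cst 0)).
  by rewrite Rintegral_cst//= mul0r.
move=> x; rewrite inE /= in_itv/= => /andP[x1 _].
by rewrite /box ler_norml [x <= 1]leNgt x1 andbF.
Qed.

(** Belongs to the tree of depth [k.+1]: a vertex just above the leaves already carries [box]. *)
Definition root_profile d k : R -> R := iter k (step d) box.

Lemma profile_root_profile d k : profile (root_profile d k).
Proof.
by elim: k => [|k IH]; [exact: profile_box|exact: profile_step].
Qed.

(** The invariant gives a ratio of at most [189 / 200], and [(189 / 200) ^+ 2 < 9 / 10]. *)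
Lemma edge_ratio_binary k :
  edge_ratio (root_profile 2 k) <= 1 /\ edge_ratio (root_profile 2 k) ^+ 2 <= 9 / 10.
Proof.
have pk := profile_root_profile 2 k.
have [bk _] : binary_invariant (root_profile 2 k).
  elim: k {pk} => [|k IH]; last first.
    exact: binary_invariant_step (profile_root_profile _ _) IH.
  have := near_mass_gt0 _ profile_box.
  by rewrite /binary_invariant far_mass_box => a0; split; [|left]; lra.
have := edge_ratio_le _ _ pk bk; have := edge_ratio_ge0 _ pk => c0 cle.
by split; [lra|nra].
Qed.

Lemma edge_ratio_ternary d k : (3 <= d)%N ->
  edge_ratio (root_profile d k) <= 1 /\
  edge_ratio (root_profile d k) ^+ d <= (3 / 4) ^+ d.
Proof.
move=> d3; have pk := profile_root_profile d k.
have bk : far_mass (root_profile d k) <= 1 / 4 * near_mass (root_profile d k).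
  elim: k {pk} => [|k IH]; last first.
    exact: far_mass_step_le_quarter (profile_root_profile _ _) IH.
  by have := near_mass_gt0 _ profile_box; rewrite far_mass_box; lra.
have := edge_ratio_le _ _ pk bk; have := edge_ratio_ge0 _ pk => c0 cle.
by split; [|apply: lerXn2r; rewrite ?nnegrE]; lra.
Qed.

(** By [step_succ], each unit moved outwards goes back one profile and raises the bound to the power
    [d]; the base case supplies [B], and [box] vanishes beyond 1. *)
Lemma root_profile_decay d (B : R) : (0 < d)%N -> 0 <= B ->
  (forall k, edge_ratio (root_profile d k) <= 1 /\
    edge_ratio (root_profile d k) ^+ d <= B) ->
  forall n k x, 0 < x -> root_profile d k (n.+1%:R + x) <= B ^+ (d ^ n).
Proof.
move=> d0 B0 rB; elim=> [|n IH] [|k] x x0.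
- by rewrite /= /box ler_norml [_ <= 1]leNgt ltrDl x0 andbF exprn_ge0.
- have pk := profile_root_profile d k; have [_ rk] := rB k.
  apply: (le_trans (step_succ d _ _ pk (ltW x0))); rewrite expn0 expr1 (le_trans _ rk)//.
  have c0 := edge_ratio_ge0 _ pk.
  have f0 := profile_ge0 _ pk.
  apply: lerXn2r; rewrite ?nnegrE//; first exact: mulr_ge0.
  by rewrite ler_piMl// profile_le1.
- rewrite /= /box ler_norml [_ <= 1]leNgt (_ : 1 < _) ?andbF ?exprn_ge0//.
  by rewrite -natr1 addrAC ltrDr addr_gt0// ltr0n.
have pk := profile_root_profile d k; have [rk _] := rB k.
have x1 : 0 <= n.+1%:R + x by rewrite addr_ge0// ltW.
rewrite (_ : n.+2%:R = 1 + n.+1%:R :> R) ?nat1r// -addrA.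
apply: (le_trans (step_succ d _ _ pk x1)); rewrite expnSr exprM.
have c0 := edge_ratio_ge0 _ pk; have f0 := profile_ge0 _ pk.
apply: lerXn2r; rewrite ?nnegrE ?exprn_ge0//; first exact: mulr_ge0.
by rewrite (le_trans _ (IH k x x0))// ler_piMr.
Qed.

(** Submultiplicativity gives [f y <= f t * f (y - t)] for [y >= t]; the shift disappears in the
    integral over the whole line. *)
Lemma profile_tail_le f t : profile f -> 0 <= t ->
  (\int[mu]_(y in `[t, +oo[) (f y)%:E <= (f t)%:E * \int[mu]_y (f y)%:E)%E.
Proof.
move=> pf t0; have f0 := profile_ge0 _ pf; have bf := profile_bounded_measurable _ pf.
have bs := bounded_measurable_shift _ (- t) bf.
have [mf _] := bf; have [ms _] := bs.
rewrite -(ge0_integral_shift _ (- t))// -ge0_integralZl//; last 3 first.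
- exact/measurable_EFinP.
- by move=> x _; rewrite lee_fin.
- by rewrite lee_fin.
have mE : measurable_fun [set: measurableTypeR R]
    (fun y => ((f t)%:E * (f (y - t))%:E)%E).
  by apply/measurable_EFinP; exact: measurable_funM.
apply: (@le_trans _ _
  (\int[mu]_(y in `[t, +oo[) ((f t)%:E * (f (y - t)%R)%:E))%E); last first.
  by apply: ge0_subset_integral => // x _; rewrite mule_ge0// lee_fin.
apply: ge0_le_integral => //.
- by move=> x _; rewrite lee_fin.
- by apply/measurable_EFinP; exact: measurable_funS mf.
- exact: measurable_funS mE.
- move=> x /=; rewrite in_itv/= andbT => tx.
  rewrite -EFinM lee_fin -{1}(subrK t x) addrC; apply: profile_sub => //.
  by rewrite subr_ge0.
Qed.

(** The total mass of admissible labellings of the subtree below an edge, as a function of the upper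
    label, when the lower end has height [i]. *)
Fixpoint message d i : R -> R :=
  if i is j.+1 then window (fun y => message d j y ^+ d) else box.

(** [window] is linear, so normalising at each step changes the messages by constants only. *)
Lemma message_root_profile d i : (0 < d)%N ->
  exists2 c, 0 < c & forall x, message d i x ^+ d = c * root_profile d i x.
Proof.
move=> d0; elim: i => [|i [c c0 IH]] /=.
  exists 1 => // x; rewrite mul1r /box.
  by case: (_ <= _); rewrite ?expr1n// expr0n gtn_eqF.
have pi := profile_root_profile d i.
have w0 : 0 < window (root_profile d i) 0.
  by apply: window_gt0 => //; apply/andP; split; lra.
exists ((c * window (root_profile d i) 0) ^+ d); first by rewrite exprn_gt0// mulr_gt0.
move=> x; rewrite /step -exprMn; congr (_ ^+ _).
rewrite [RHS](_ : _ = c * window (root_profile d i) x); last first.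
  by field; rewrite gt_eqF.
rewrite /window -itv_intZ; last exact: profile_bounded_measurable.
by apply: itv_int_eq => y _.
Qed.

End root_profile.

(** * Integrating out the tree *)

Section iterated_integral.
Context {R : realType}.
Local Notation mu := (@lebesgue_measure R).
Implicit Types (F G : seq R -> \bar R).

Fixpoint iterated_int n F : \bar R :=
  if n is m.+1 then (\int[mu]_x iterated_int m (fun s => F (x :: s)))%E
  else F [::].

Lemma eq_iterated_int n F G : (forall s, size s = n -> F s = G s) ->
  iterated_int n F = iterated_int n G.
Proof.
elim: n F G => [|n IH] F G FG /=; first exact: FG.
by apply: eq_integral => x _; apply: IH => s sn; apply: FG; rewrite /= sn.
Qed.

(** The last entry is the innermost variable, so it is integrated out with no exchange of
    integrals. *)
Lemma iterated_int_rcons n F : iterated_int n.+1 F =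
  iterated_int n (fun s => (\int[mu]_y F (rcons s y))%E).
Proof.
elim: n F => [//|n IH] F.
by apply: eq_integral => x _; exact: (IH (fun s => F (x :: s))).
Qed.

(* Holds for arbitrary [P]: the product measure of a set is defined as the
   integral of the measures of its sections. *)
Lemma lebesgue_tuple_iterated n (P : set (seq R)) :
  lebesgue_tuple R n [set t : n.-tuple (measurableTypeR R) | P (tval t)] =
  iterated_int n (fun s => (\1_P s)%:E).
Proof.
elim: n P => [|n IH] P /=.
  by rewrite diracE indicE; congr (nat_of_bool _)%:R%:E; apply/idP/idP; rewrite !inE.
rewrite /lebesgue_cons /pushforward /product_measure1.
apply: eq_integral => x _ /=.
rewrite (_ : xsection _ x = [set t : n.-tuple (measurableTypeR R) | P (x :: tval t)]).
  exact: (IH (fun s => P (x :: s))).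
by apply/seteqP; split => t; rewrite /xsection /= inE.
Qed.

End iterated_integral.

(** * Vertices listed by depth *)

Section vertex_order.
Context (d k : nat).
Local Notation vtx := (vertex d k).
Local Notation vs := (enum (internal d k)).
Implicit Types (c u v : vtx).

(* The library enumerates bounded sequences by increasing size, so that children
   come after their parents and can be integrated out first. *)
Lemma sorted_size_enum : sorted (relpre (fun v : vtx => size v) leq) vs.
Proof.
rewrite sorted_pairwise; last by move=> ? ? ?; exact: leq_trans.
rewrite /enum_mem; apply: (subseq_pairwise (filter_subseq _ _)).
rewrite Finite.enum.unlock; apply: (subseq_pairwise (undup_subseq _)).
have pmapE A B (g : A -> B) s : pmap (fun x => Some (g x)) s = map g s.
  by elim: s => //= a s ->.
rewrite pmapE pairwise_map Finite.enum.unlock /= /tag_enum.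
(* The enumeration is a concatenation of blocks, one for each length, in increasing order. *)
have : pairwise (relpre (@nat_of_ord k.+1) leq) (Finite.enum 'I_k.+1).
  rewrite -pairwise_map -enumT val_enum_ord -sorted_pairwise.
    exact: iota_sorted.
  exact: leq_trans.
elim: (Finite.enum 'I_k.+1) => [//|i L IH] /= /andP[/allP iL /IH pL].
rewrite pairwise_cat pL andbT; apply/andP; split.
  apply/allrelP => x y /mapP[t _ ->] /flatten_mapP[j jL /mapP[t' _ ->]] /=.
  by rewrite !size_tuple; exact: iL.
elim: (Finite.enum _) => [//|t l IHl] /=; rewrite IHl andbT.
by apply/allP => _ /mapP[t' _ ->] /=; rewrite !size_tuple.
Qed.

Lemma sorted_index_size u v : u \in vs -> v \in vs ->
  (size u < size v)%N -> (index u vs < index v vs)%N.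
Proof.
move=> uvs vvs; apply: contraTT; rewrite -!leqNgt => vu.
have [uv|ne] := eqVneq u v; first by rewrite uv.
apply: (sorted_ltn_index _ sorted_size_enum v u) => //.
  by move=> ? ? ?; exact: leq_trans.
rewrite ltn_neqAle vu andbT; apply: contraNneq ne => /(congr1 (nth u vs)).
by rewrite !nth_index// => ->.
Qed.

Lemma mem_internal v : (v \in vs) = (size v < k)%N.
Proof.
by rewrite mem_enum /in_mem /= /internal /leaf ltn_neqAle size_bseq andbT.
Qed.

(** The root becomes its own parent; edges correspond to the vertices of positive size. *)
Definition parent v : vtx := [bseq of take (size v).-1 v].

Lemma size_parent v : size (parent v) = (size v).-1.
Proof. by rewrite /= size_takel// leq_pred. Qed.

Lemma index_leaf v : size v = k -> index v vs = size vs.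
Proof.
by move=> vk; apply/eqP; rewrite eqn_leq index_size leqNgt index_mem mem_internal vk ltnn.
Qed.

Lemma index_parent_lt v : (0 < size v)%N -> (index (parent v) vs < index v vs)%N.
Proof.
move=> v0; have pk : parent v \in vs.
  by rewrite mem_internal size_parent prednK// size_bseq.
have [vk|] := boolP (v \in vs); last first.
  by move=> /negPf vk; rewrite (memNindex (negbT vk)) index_mem.
by apply: sorted_index_size => //; rewrite size_parent prednK.
Qed.

Lemma index_parent_mem v : (0 < size v)%N -> (index (parent v) vs < size vs)%N.
Proof. by move=> /index_parent_lt /leq_trans; apply; exact: index_size. Qed.

Lemma index_root : (0 < k)%N -> index (tree_root d k) vs = 0%N.
Proof.
move=> k0; apply/eqP; rewrite -leqn0 leqNgt; apply/negP => r0.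
have rvs : tree_root d k \in vs by rewrite mem_internal.
have vs0 : (0 < size vs)%N by case: vs rvs.
have := @sorted_index_size (tree_root d k) (nth (tree_root d k) vs 0) rvs (mem_nth _ vs0).
have [s0|s0] := posnP (size (nth (tree_root d k) vs 0)); last first.
  by move=> /(_ isT); rewrite index_uniq ?enum_uniq.
have /val_inj/esym : val (nth (tree_root d k) vs 0) = val (tree_root d k).
  exact/size0nil.
by move=> e; move: r0; rewrite e index_uniq ?enum_uniq.
Qed.

Lemma childE u v : child u v = (0 < size v)%N && (parent v == u).
Proof.
apply/existsP/andP => [[i /eqP vE]|[v0 /eqP <-]].
  split; first by rewrite vE size_rcons.
  by apply/eqP/val_inj; rewrite /= vE size_rcons /= -cats1 take_size_cat.
have [i0 _|] := pickP (fun i : 'I_d => i \in bseqval v); last first.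
  move=> e; exfalso; move: v0 e; case: (bseqval v) => //= i s _ /(_ i).
  by rewrite inE eqxx.
exists (last i0 v); apply/eqP => /=.
case/lastP: (bseqval v) v0 => // s i _.
by rewrite size_rcons last_rcons /= -cats1 take_size_cat ?cats1.
Qed.

Lemma card_children u : (size u < k)%N ->
  #|[pred c : vtx | (0 < size c)%N && (parent c == u)]| = d.
Proof.
move=> uk; have su i : (size (rcons u i) <= k)%N by rewrite size_rcons.
pose g (i : 'I_d) : vtx := Bseq (su i).
have gi : injective g by move=> i j /(congr1 val)/= /rcons_inj[].
rewrite -[RHS]card_ord -(card_imset _ gi); apply: eq_card => c; rewrite [LHS]inE -childE.
apply/existsP/imsetP => [[i /eqP cE]|[i _ ->]]; last by exists i.
by exists i => //; exact/val_inj.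
Qed.

End vertex_order.
Arguments parent {d k}.

(** * Messages from the leaves to the root *)

Section message_passing.
Context {R : realType} (d k : nat) (d0 : (0 < d)%N) (k0 : (0 < k)%N).
Local Notation mu := (@lebesgue_measure R).
Local Notation vtx := (vertex d k).
Local Notation vs := (enum (internal d k)).
Local Notation root := (tree_root d k).
Implicit Types (c u v : vtx) (s : seq R).

Lemma bounded_measurable_message_pow i :
  bounded_measurable (fun x : R => message d i x ^+ d).
Proof.
have [c _ cE] := @message_root_profile R d i d0.
rewrite (_ : (fun x => _) = (fun x => c * root_profile d i x)); last exact/funext.
apply: (bounded_measurableM (cst c)); first exact: bounded_measurable_cst.
exact/profile_bounded_measurable/profile_root_profile.
Qed.

(** [box (y - p)] confines [y] to the window at [p], so integrating out a vertex turns its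
    children's messages into its own. *)
Lemma integral_message i (C p : R) :
  (\int[mu]_y (C * (box (y - p) * message d i y ^+ d))%:E)%E =
  (C * message d i.+1 p)%:E.
Proof.
have bg := bounded_measurable_message_pow i.
have bCg := bounded_measurableM (cst C) _ (bounded_measurable_cst C) bg.
rewrite /= /window -itv_intZ// /itv_int /Rintegral fineK; last first.
  apply: integrable_fin_num => //.
  exact: (bounded_measurable_itv_integrable _ _ _ _ _ bCg).
rewrite [RHS]integral_mkcond; apply: eq_integral => y _.
rewrite /box patchE; case: ifPn => yp.
  have -> : `|y - p| <= 1.
    by move: yp; rewrite inE /= in_itv/= ler_norml; lra.
  by rewrite mul1r.
have /negPf -> : ~~ (`|y - p| <= 1).
  apply: contraNN yp; rewrite ler_norml => /andP[? ?].
  by rewrite inE /= in_itv/=; apply/andP; split; lra.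
by rewrite mul0r mulr0.
Qed.

(** A leaf has index [size vs], where a list of full length yields the default 0, the prescribed
    value. *)
Definition label s v : R := nth 0 s (index v vs).

(* The constraint on the edge above [c], once the vertices of index at least
   [j] have been integrated out: both endpoints are left, or only the upper
   one, or none. *)
Definition factor j s c : R :=
  if (index c vs < j)%N then box (label s c - label s (parent c))
  else if (index (parent c) vs < j)%N
       then message d (k - size c) (label s (parent c)) else 1.

Definition factors j s : R := \prod_(c : vtx | (0 < size c)%N) factor j s c.

Lemma label_rcons_lt s y v : (index v vs < size s)%N ->
  label (rcons s y) v = label s v.
Proof. by move=> vs_lt; rewrite /label nth_rcons vs_lt. Qed.

Lemma label_rcons_eq s y v : index v vs = size s -> label (rcons s y) v = y.
Proof. by move=> vE; rewrite /label nth_rcons vE ltnn eqxx. Qed.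

Lemma index_eq_nth u j : (j < size vs)%N -> index u vs = j -> u = nth root vs j.
Proof. by move=> jn uj; rewrite -uj nth_index// -index_mem uj. Qed.

Lemma prod_children j s v x : (size v < k)%N ->
  (forall c, (0 < size c)%N -> parent c = v ->
    factor j s c = message d (k - (size v).+1) x) ->
  \prod_(c : vtx | (0 < size c)%N && (parent c == v)) factor j s c =
  message d (k - (size v).+1) x ^+ d.
Proof.
move=> vk fE; rewrite (eq_bigr (fun=> message d (k - (size v).+1) x)).
  by rewrite prodr_const card_children.
by move=> c /andP[c0 /eqP pc]; exact: fE.
Qed.

Lemma size_child c v : (0 < size c)%N -> parent c = v -> size c = (size v).+1.
Proof. by move=> c0 <-; rewrite size_parent prednK. Qed.

(** Only the edges at [v] involve its label. Its children come later and have already become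
    messages, so the last variable meets one edge constraint and [d] equal messages; [C] collects
    the other factors. *)
Lemma factors_step j s (v := nth root vs j) : (0 < j < size vs)%N -> size s = j ->
  exists2 C, forall y, factors j.+1 (rcons s y) =
      C * (box (y - label s (parent v)) * message d (k - (size v).+1) y ^+ d) &
    factors j s = C * message d (k - size v) (label s (parent v)).
Proof.
move=> /andP[j0 jn] sj.
have vvs : v \in vs by exact: mem_nth.
have iv : index v vs = j by rewrite index_uniq ?enum_uniq.
have vk : (size v < k)%N by rewrite -mem_internal.
have v0 : (0 < size v)%N.
  rewrite lt0n; apply: contraTneq j0 => /size0nil v0.
  by rewrite -iv (_ : v = root) ?index_root//; exact/val_inj.
have pv := index_parent_lt _ _ v v0; rewrite iv in pv.
have kv : (k - size v)%N = (k - (size v).+1).+1 by rewrite subnSK.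
pose rest c := [&& 0 < size c, c != v & parent c != v]%N.
have split_v (F : vtx -> R) : \prod_(c : vtx | (0 < size c)%N) F c =
    F v * (\prod_(c : vtx | (0 < size c)%N && (parent c == v)) F c *
           \prod_(c | rest c) F c).
  rewrite (bigD1 v)//= (bigID (fun c => parent c == v))/=; congr (_ * (_ * _)).
    apply: eq_bigl => c; have [-> |ncv] := eqVneq c v; last by rewrite andbT.
    rewrite andbF; apply/esym/negbTE/nandP; right; apply/eqP => pvv.
    by move: pv; rewrite pvv iv ltnn.
  by apply: eq_bigl => c; rewrite /rest andbA.
have child_lt c : (0 < size c)%N -> parent c = v -> (j < index c vs)%N.
  by move=> c0 pc; rewrite -iv -pc; exact: index_parent_lt.
exists (\prod_(c | rest c) factor j s c).
- move=> y; rewrite /factors split_v mulrA mulrC; congr (_ * _).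
    (* Neither end of such an edge has index [j], so the threshold [j.+1] acts as [j]. *)
    apply: eq_bigr => c /and3P[c0 cv pcv]; rewrite /factor.
    have pc := index_parent_lt _ _ c c0.
    have cj : index c vs != j.
      by apply: contraNneq cv => /(index_eq_nth _ _ jn) ->.
    have pcj : index (parent c) vs != j.
      by apply: contraNneq pcv => /(index_eq_nth _ _ jn) ->.
    have ltE i : i != j -> (i < j.+1)%N = (i < j)%N.
      by move=> /negPf ij; rewrite ltnS leq_eqVlt ij.
    rewrite !ltE//.
    case: ifPn => [cltj|_].
      by rewrite !label_rcons_lt ?sj ?(ltn_trans pc cltj).
    by case: ifPn => // pltj; rewrite label_rcons_lt ?sj.
  rewrite {1}/factor iv ltnSn label_rcons_eq ?iv//.
  rewrite label_rcons_lt ?sj//; congr (_ * _).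
  apply: prod_children => // c c0 pc; rewrite /factor ltnS leqNgt child_lt//= pc iv ltnSn.
  by rewrite label_rcons_eq ?iv ?sj// (size_child c v).
- rewrite /factors split_v mulrA mulrC; congr (_ * _).
  rewrite [X in _ * X]big1 ?mulr1; last first.
    move=> c /andP[c0 /eqP pc].
    by rewrite /factor ltnNge ltnW ?child_lt//= pc iv ltnn.
  by rewrite /factor iv ltnn pv.
Qed.

Variable A : set R.

Definition weight j s : R := \1_A (label s root) * factors j s.

Lemma weight_step j : (0 < j < size vs)%N ->
  iterated_int j.+1 (fun s => (weight j.+1 s)%:E) =
  iterated_int j (fun s => (weight j s)%:E).
Proof.
move=> jn; rewrite iterated_int_rcons; apply: eq_iterated_int => s sj.
have [C C1 C2] := factors_step j s jn sj.
have /andP[j0 jlt] := jn.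
have wE y : weight j.+1 (rcons s y) = \1_A (label s root) * C *
    (box (y - label s (parent (nth root vs j))) *
     message d (k - (size (nth root vs j)).+1) y ^+ d).
  by rewrite /weight C1 label_rcons_lt ?index_root ?sj//; exact: mulrA.
under eq_integral do rewrite wE.
rewrite integral_message /weight C2 mulrA; congr (_ * message d _ _)%:E.
by rewrite subnSK// -mem_internal mem_nth.
Qed.

Lemma size_vs_gt0 : (0 < size vs)%N.
Proof.
have : root \in vs by rewrite mem_internal.
by case: (enum _).
Qed.

Lemma weight_integral :
  iterated_int (size vs) (fun s => (weight (size vs) s)%:E) =
  (\int[mu]_y (\1_A y * message d k.-1 y ^+ d)%:E)%E.
Proof.
have n0 := size_vs_gt0.
transitivity (iterated_int 1 (fun s => (weight 1 s)%:E)).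
  suff wE j : (0 < j <= size vs)%N -> iterated_int j (fun s => (weight j s)%:E) =
      iterated_int 1 (fun s => (weight 1 s)%:E) by apply: wE; rewrite n0 leqnn.
  elim: j => [//|[//|j] IH] jn.
  by rewrite weight_step// IH//= ltnW.
apply: eq_integral => y _; congr (_ * _)%:E.
  by rewrite /label index_root.
(* With only the root left, each of its [d] children contributes a message and all other factors are
   1. *)
rewrite /factors (bigID (fun c => parent c == root))/= [X in _ * X]big1 ?mulr1.
  rewrite -(subn1 k); apply: prod_children => // c c0 pc.
  have ic : (0 < index c vs)%N by rewrite -(index_root d k k0) -pc index_parent_lt.
  rewrite /factor ltnNge ic pc index_root//=.
  by rewrite (size_child c root c0 pc)/= /label index_root.
move=> c /andP[c0 pc]; rewrite /factor.
have ic : (0 < index (parent c) vs)%N.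
  rewrite lt0n; apply: contraNneq pc => p0; apply/eqP.
  by rewrite (index_eq_nth _ _ n0 p0) -(index_eq_nth root _ n0)// index_root.
have cc := index_parent_lt _ _ c c0.
have lt1 i : (0 < i)%N -> (i < 1)%N = false by case: i.
by rewrite !lt1// (ltn_trans ic cc).
Qed.

Lemma label_leaf s v : size s = size vs -> leaf v -> label s v = 0.
Proof. by move=> sn /eqP vk; rewrite /label index_leaf// -sn nth_default. Qed.

Lemma Lipschitz_label s :
  @Lipschitz R d k (label s) <->
  forall c, (0 < size c)%N -> `|label s c - label s (parent c)| <= 1.
Proof.
split=> [Ls c c0|Ls u v].
  by apply: Ls; rewrite /Defs.adjacent !childE c0 eqxx orbT.
rewrite /Defs.adjacent !childE.
move=> /orP[/andP[v0 /eqP <-]|/andP[u0 /eqP <-]]; last exact: Ls.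
by rewrite distrC; exact: Ls.
Qed.

Lemma factorsE s : size s = size vs -> factors (size vs) s =
  [forall c : vtx, (0 < size c)%N ==> (`|label s c - label s (parent c)| <= 1)]%:R.
Proof.
move=> sn.
transitivity (\prod_(c : vtx | (0 < size c)%N)
    (`|label s c - label s (parent c)| <= 1)%R%:R : R).
  apply: eq_bigr => c c0; rewrite /factor index_parent_mem//.
  (* An edge to a leaf appears as [message d 0 = box] at the upper label, which is its constraint
     because the leaf has label 0. *)
  case: ifPn => //; rewrite index_mem mem_internal -leqNgt => ck.
  have sc : size c = k by apply/eqP; rewrite eqn_leq ck size_bseq.
  by rewrite sc subnn /= /box (label_leaf s c)// ?/leaf ?sc// sub0r normrN.
have [h|/(introN forallP)/forallPn[c]] := forallP.
  by rewrite big1// => c c0; have := h c; rewrite c0 /= => ->.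
rewrite negb_imply => /andP[c0 /negPf nc].
by rewrite (bigD1 c)//= nc mul0r.
Qed.

(** With all vertices present, [weight] is the indicator of the event. *)
Lemma volume_root_event :
  volume (L_infty R d k `&` [set f | A (f root)]) =
  (\int[mu]_y (\1_A y * message d k.-1 y ^+ d)%:E)%E.
Proof.
pose P : set (seq R) := [set s | (L_infty R d k `&` [set f | A (f root)]) (label s)].
rewrite /volume restriction_image; last by move=> f [].
transitivity (lebesgue_tuple R #|internal d k|
  [set t : _.-tuple (measurableTypeR R) | P (tval t)]); first by [].
rewrite lebesgue_tuple_iterated -weight_integral cardE.
apply: eq_iterated_int => s sn; congr EFin.
rewrite /weight factorsE// !indicE -natrM mulnb; congr (nat_of_bool _)%:R.
apply/idP/andP; rewrite !inE.
  move=> [[Ls _] As]; split=> //; apply/forallP => c; apply/implyP.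
  exact: (Lipschitz_label s).1.
move=> [As /forallP Ls]; split => //; split; last by move=> v; exact: label_leaf.
by apply/Lipschitz_label => c; apply/implyP; exact: Ls.
Qed.

End message_passing.

(** * Tail bounds for the root value *)

(** The constant relating messages to profiles cancels in the quotient of volumes, leaving a
    normalised tail of the profile. *)
Lemma Pr_root_le (R : realType) (d k : nat) (t : R) :
  (0 < d)%N -> (0 < k)%N -> 0 <= t ->
  (Pr_L_infty R d k [set f : vertex d k -> R | (t <= f (tree_root d k))%R] <=
    (root_profile d k.-1 t)%:E)%E.
Proof.
move=> d0 k0 t0; set p := root_profile d k.-1.
have pp : profile p by exact: profile_root_profile.
have p0 := profile_ge0 _ pp; have [mp _] := profile_bounded_measurable _ pp.
have [c c0 cE] := @message_root_profile R d k.-1 d0.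
pose I (D : set R) := (\int[@lebesgue_measure R]_(y in D) (p y)%:E)%E.
have volE (D : set (measurableTypeR R)) : measurable D ->
    volume (L_infty R d k `&` [set f | D (f (tree_root d k))]) = (c%:E * I D)%E.
  move=> mD; rewrite (volume_root_event _ _ d0 k0) /I.
  rewrite -ge0_integralZl//.
  - rewrite [RHS]integral_mkcond; apply: eq_integral => y _; rewrite cE patchE indicE.
    by case: ifPn => _; rewrite ?mul1r ?mul0r.
  - by apply/measurable_EFinP; exact: measurable_funS mp.
  - by move=> y _; rewrite lee_fin.
  - by rewrite lee_fin ltW.
have VE : volume (L_infty R d k) = (c%:E * I setT)%E.
  by rewrite -volE// (_ : [set f | _] = setT) ?setIT//; apply/seteqP.
have num : volume (L_infty R d k `&` [set f | t <= f (tree_root d k)]) =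
    (c%:E * I `[t, +oo[%classic)%E.
  rewrite -volE//; congr (volume (_ `&` _)).
  by apply/seteqP; split => f /=; rewrite in_itv/= andbT.
have Vfin : volume (L_infty R d k) \is a fin_num.
  by rewrite ge0_fin_numE ?volume_L_infty_lty// ltW// volume_L_infty_gt0.
have V0 := volume_L_infty_gt0 R d k.
rewrite /Pr_L_infty num -(fineK Vfin) inver gt_eqF ?fine_gt0 ?V0 ?volume_L_infty_lty//.
rewrite lee_pdivrMr ?fine_gt0 ?V0 ?volume_L_infty_lty// fineK// VE muleCA.
apply: lee_wpmul2l; first by rewrite lee_fin ltW.
exact: profile_tail_le.
Qed.

Lemma Pr_root_decay (R : realType) (d k : nat) (B : R) :
  (0 < d)%N -> (0 < k)%N -> 0 <= B ->
  (forall j, edge_ratio (root_profile d j) <= 1 :> R /\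
    edge_ratio (root_profile d j) ^+ d <= B) ->
  forall x : R, 0 < x ->
  (Pr_L_infty R d k [set f : vertex d k -> R | (f (tree_root d k) >= 1 + x)%R] <=
    (B ^+ (d ^ `|Num.ceil x - 1|)%N)%:E)%E.
Proof.
move=> d0 k0 B0 rB x x0.
apply: (le_trans (Pr_root_le _ _ _ _ d0 k0 _)); first by rewrite addr_ge0// ltW.
have nE : `|Num.ceil x - 1|%N%:R = (Num.ceil x - 1)%:~R :> R.
  have m0 : 0 <= Num.ceil x - 1 by rewrite subr_ge0 -gtz0_ge1 ceil_gt0.
  by rewrite -[in RHS](gez0_abs m0).
have := ceilB1_lt x; rewrite -nE; set n := `|_|%N => nx.
(* Here [n] is the ceiling of [x] minus 1, so the remainder [x - n] is positive. *)
rewrite lee_fin (_ : 1 + x = n.+1%:R + (x - n%:R)).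
  by apply: root_profile_decay => //; rewrite subr_gt0.
by rewrite -natr1; ring.
Qed.

Theorem theorem1p2 (R : realType) (d k : nat) (hd : (2 <= d)%N)
    (hk : (1 <= k)%N) :
  (forall x : R, 0 < x ->
    (Pr_L_infty R d k [set f : vertex d k -> R | (f (tree_root d k) >= 1 + x)%R] <=
      (2 ^+ (d + 2) * (9 / 10) ^+ (d ^ `|Num.ceil x - 1|)%N)%R%:E)%E) /\
  ((3 <= d)%N -> forall x : R, 0 < x ->
    (Pr_L_infty R d k [set f : vertex d k -> R | (f (tree_root d k) >= 1 + x)%R] <=
      (2 ^+ (d + 2) * ((3 / 4) ^+ d) ^+ (d ^ `|Num.ceil x - 1|)%N)%R%:E)%E).
Proof.
have d0 : (0 < d)%N by exact: leq_trans hd.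
(* The decay holds with constant 1; the factor [2 ^+ (d + 2) >= 1] and a larger base weaken it. *)
have weaken (B C : R) m : 0 <= B -> B <= C -> B ^+ m <= 2 ^+ (d + 2) * C ^+ m.
  move=> B0 BC; have C0 : 0 <= C by exact: le_trans BC.
  apply: (@le_trans _ _ (C ^+ m)); first by apply: lerXn2r.
  by rewrite ler_peMl ?exprn_ge0// exprn_ege1// ler1n.
have B0 : 0 <= (3 / 4) ^+ d :> R by rewrite exprn_ge0//; lra.
have B1 : (3 / 4) ^+ d <= 9 / 10 :> R.
  have : (3 / 4) ^+ d <= (3 / 4) ^+ 2 :> R by apply: ler_wiXn2l => //; lra.
  lra.
split=> [x x0|d3 x x0]; last first.
  apply: (le_trans (Pr_root_decay _ _ _ _ d0 hk B0 _ x x0)); last first.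
    by rewrite lee_fin weaken.
  by move=> j; exact: edge_ratio_ternary.
(* For [d >= 3] the sharper base serves, as [(3 / 4) ^+ d <= (3 / 4) ^+ 2 < 9 / 10]; [d = 2] uses
   the binary invariant. *)
have [d3|] := leqP 3 d.
  apply: (le_trans (Pr_root_decay _ _ _ _ d0 hk B0 _ x x0)); last first.
    by rewrite lee_fin weaken.
  by move=> j; exact: edge_ratio_ternary.
rewrite ltnS => d2; have dE : d = 2%N by apply/eqP; rewrite eqn_leq d2.
have C0 : 0 <= 9 / 10 :> R by lra.
apply: (le_trans (Pr_root_decay _ _ _ _ d0 hk C0 _ x x0)); last by rewrite lee_fin weaken.
by rewrite dE; exact: edge_ratio_binary.
Qed.
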